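(* Let $V$ be a finite set and let $R:V\times V\to 2^V$ be a poset function. Define a relation $\succeq_R$ on $V$ by: $u\succeq_R v$ if and only if $R(u,v)\neq\emptyset$. Then $\succeq_R$ is a partial order on $V$. Moreover $R_{\succeq_R}=R$, where for a partial order $\succeq$ on $V$ the function $R_{\succeq}:V\times V\to 2^V$ is defined by $R_{\succeq}(u,v)=\{x\in V\mid u\succeq x \text{ and } x\succeq v\}$.
   Context: Let $V$ be a finite set. A directed transit function on $V$ is a function $R:V\times V\to 2^V$ satisfying (t0) for all $u,v,w\in V$: if $R(u,w)\neq\emptyset$ and $R(w,v)\neq\emptyset$ then $R(u,v)\neq\emptyset$; (t1) for all $u,v\in V$: if $R(u,v)\neq\emptyset$ then $\{u,v\}\subseteq R(u,v)$; (t3) $R(u,u)=\{u\}$ for all $u\in V$. A poset function is a directed transit function that in addition satisfies (t2a) for all $u,v\in V$: if $R(u,v)\neq\emptyset$ and $u\neq v$ then $R(v,u)=\emptyset$; (tr1) for all $u,v,w\in V$ with $u\neq v$: if $R(u,w)\neq\emptyset$ and $R(w,v)\neq\emptyset$ then $R(u,w)\cup R(w,v)\subseteq R(u,v)$; (tr2) for all $u,v,w\in V$ with $u\neq v$: if $R(u,w)=\emptyset$ or $R(w,v)=\emptyset$ then $w\notin R(u,v)$. A partial order is a reflexive, antisymmetric, transitive relation. *)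

(* Defs.v *)
From mathcomp Require Import all_boot.

Set Implicit Arguments.
Unset Strict Implicit.
Unset Printing Implicit Defensive.

Record directed_transit_function (V : finType) (R : V -> V -> {set V}) : Prop :=
  DirectedTransitFunction {
    axiom_t0 : forall u v w : V,
      R u w != set0 -> R w v != set0 -> R u v != set0;
    axiom_t1 : forall u v : V, R u v != set0 -> [set u; v] \subset R u v;
    axiom_t3 : forall u : V, R u u = [set u]
  }.

Record poset_function (V : finType) (R : V -> V -> {set V}) : Prop :=
  PosetFunction {
    poset_function_transit : directed_transit_function R;
    axiom_t2a : forall u v : V, R u v != set0 -> u <> v -> R v u = set0;
    axiom_tr1 : forall u v w : V, u <> v ->
      R u w != set0 -> R w v != set0 -> R u w :|: R w v \subset R u v;
    axiom_tr2 : forall u v w : V, u <> v ->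
      R u w = set0 \/ R w v = set0 -> w \notin R u v
  }.

Definition partial_order (V : finType) (ge : rel V) : Prop :=
  [/\ reflexive ge, antisymmetric ge & transitive ge].

Definition ge_of (V : finType) (R : V -> V -> {set V}) : rel V :=
  fun u v => R u v != set0.

(* [ge u v] reads "u is above v", so the interval is listed from its
   upper end u to its lower end v. *)
Definition transit_of (V : finType) (ge : rel V) (u v : V) : {set V} :=
  [set x | ge u x && ge x v].

(* Main.v *)
Require Import Defs.
From mathcomp Require Import all_boot.

(** The order laws are [t3], [t2a] and [t0] read through nonemptiness. Off the diagonal, if x lies
    between u and v, then x is in R(u,x) by [t1], hence in R(u,v) by [tr1]; the converse is the
    contrapositive of [tr2]. *)

Theorem theorem4 (V : finType) (R : V -> V -> {set V}) (HR : poset_function R) :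
  partial_order (ge_of R) /\ transit_of (ge_of R) =2 R.
Proof.
case: HR => -[t0 t1 t3] t2a tr1 tr2.
have ge_refl : reflexive (ge_of R).
  by move=> u; rewrite /ge_of t3; apply/set0Pn; exists u; rewrite set11.
have ge_anti : antisymmetric (ge_of R).
  move=> u v /andP[uv vu]; apply/eqP/negPn/negP => /eqP neq_uv.
  by move: vu; rewrite /ge_of (t2a u v uv neq_uv) eqxx.
have ge_trans : transitive (ge_of R) by move=> w u v; apply: t0.
split=> // u v; apply/setP => x; rewrite inE.
(* [tr1] and [tr2] assume distinct endpoints; on the diagonal, antisymmetry collapses the interval
   to the singleton given by [t3]. *)
have [<-|/eqP neq_uv] := eqVneq u v.
  rewrite t3 inE; apply/idP/eqP => [|->]; last by rewrite ge_refl.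
  by rewrite andbC; apply: ge_anti.
apply/andP/idP => [[ux xv]|].
  apply: (subsetP (tr1 u v x neq_uv ux xv)); rewrite inE.
  by rewrite (subsetP (t1 u x ux)) // !inE eqxx orbT.
move=> xuv; split; apply/negP => /eqP R0.
  by move: xuv; apply/negP/tr2 => //; left.
by move: xuv; apply/negP/tr2 => //; right.
Qed.
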